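(* Let $k\ge2$. For any two elements $\varphi,\psi\in M_{k,1}$ such that $\varphi>_{\mathcal L}\psi$ there exists $\chi\in M_{k,1}$ such that $\varphi>_{\mathcal L}\chi>_{\mathcal L}\psi$.
   Context: $A$ is an alphabet with $k\ge2$ letters, $A^*$ the free monoid over $A$. A right ideal of $A^*$ is a set $R\subseteq A^*$ with $RA^*\subseteq R$. A right ideal homomorphism is a function $\varphi$ whose domain ${\sf Dom}(\varphi)\subseteq A^*$ is a right ideal, with values in $A^*$ and $\varphi(xw)=\varphi(x)w$ for all $x\in{\sf Dom}(\varphi)$, $w\in A^*$. ${\sf riHom}(A^* )$ is the set of right ideal homomorphisms with finitely generated domain. A right ideal $R'\subseteq R$ is essential in the right ideal $R$ iff $R'$ intersects every nonempty right ideal contained in $R$. $\Phi$ is an essentially equal restriction of $\varphi$ (and $\varphi$ an essentially equal extension of $\Phi$) iff $\Phi$ is a restriction of $\varphi$ and ${\sf Dom}(\Phi)$ is essential in ${\sf Dom}(\varphi)$. Every $\varphi\in{\sf riHom}(A^* )$ has a unique maximal essentially equal extension $\max(\varphi)$. The Thompson-Higman monoid is $M_{k,1}=\{\max(\varphi):\varphi\in{\sf riHom}(A^* )\}$ with multiplication $\psi\varphi=\max(\psi\circ\varphi)$ (functions act on the left). $u\le_{\mathcal L}v$ means $u=xv$ for some $x\in M_{k,1}$; $u\equiv_{\mathcal L}v$ means $u\le_{\mathcal L}v$ and $v\le_{\mathcal L}u$; $v>_{\mathcal L}u$ means $u\le_{\mathcal L}v$ and not $u\equiv_{\mathcal L}v$.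 *)

(* Defs.v *)
From mathcomp Require Import all_boot all_classical.

Set Implicit Arguments.
Unset Strict Implicit.
Unset Printing Implicit Defensive.

Local Open Scope classical_set_scope.

(* Words over A form the free monoid A^*, with [::] as unit and ++ as product.
   A partial function on A^* is an option-valued total function, None meaning
   "undefined", so Leibniz equality is equality of partial functions. *)
Definition pfun (A : finType) := seq A -> option (seq A).

Section ThompsonHigman.
Variable A : finType.

Implicit Types (R I : set (seq A)) (phi psi chi f g h : pfun A).

Definition right_ideal R := forall x w : seq A, R x -> R (x ++ w).

Definition gen_ideal (s : seq (seq A)) : set (seq A) :=
  [set x | exists2 p, p \in s & exists w, x = p ++ w].

Definition fin_gen R := exists s : seq (seq A), R = gen_ideal s.

Definition essential (R' : set (seq A)) R :=
  [/\ right_ideal R, right_ideal R', R' `<=` R &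
      forall I, right_ideal I -> I !=set0 -> I `<=` R -> (R' `&` I) !=set0].

Definition dom phi : set (seq A) := [set x | exists y, phi x = Some y].

Definition ri_homomorphism phi :=
  right_ideal (dom phi) /\
  forall x y w : seq A, phi x = Some y -> phi (x ++ w) = Some (y ++ w).

Definition riHom : set (pfun A) :=
  [set phi | ri_homomorphism phi /\ fin_gen (dom phi)].

Definition restriction f g := forall x y, f x = Some y -> g x = Some y.

Definition ess_eq_restriction f g :=
  restriction f g /\ essential (dom f) (dom g).

Definition max_ess_eq_extension f g :=
  [/\ riHom g, ess_eq_restriction f g &
      forall h, riHom h -> ess_eq_restriction f h -> restriction g h -> h = g].

(* The default value f is never used when f is in riHom: see maxextP. *)
Definition maxext f : pfun A := xget f [set g | max_ess_eq_extension f g].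

Definition Mk1 : set (pfun A) := maxext @` riHom.

Definition pcomp psi phi : pfun A := fun x => obind psi (phi x).

Definition Mmul psi phi := maxext (pcomp psi phi).

Definition leL phi psi := exists2 chi, Mk1 chi & phi = Mmul chi psi.

Definition eqL phi psi := leL phi psi /\ leL psi phi.

Definition gtL psi phi := leL phi psi /\ ~ eqL phi psi.

Lemma ess_refl f : riHom f -> ess_eq_restriction f f.
Proof.
move=> [[fR _] _]; split=> //; split=> // I _ [x Ix] sI.
by exists x; split=> //; apply: sI.
Qed.

Lemma ess_meet f g x : ess_eq_restriction f g -> dom g x ->
  exists w, dom f (x ++ w).
Proof.
move=> [_ [gR _ _ ess]] gx.
have [||_ [w _ <-]|z [fz [w _ zE]]] := ess [set x ++ w | w in setT].
- by move=> _ v [w _ <-]; exists (w ++ v) => //; rewrite catA.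
- by exists x; exists [::] => //; rewrite cats0.
- exact: gR.
- by exists w; rewrite zE.
Qed.

Lemma ess_agree f g h x y z :
    riHom g -> ess_eq_restriction f g -> riHom h -> ess_eq_restriction f h ->
  g x = Some y -> h x = Some z -> y = z.
Proof.
move=> [[_ gM] _] fg [[_ hM] _] fh gx hx.
have [|w [v fv]] := @ess_meet f g x fg; first by exists y.
have := fg.1 _ _ fv; rewrite (gM _ _ _ gx) => -[yE].
have := fh.1 _ _ fv; rewrite (hM _ _ _ hx) => -[zE].
have yz : y ++ w = z ++ w by rewrite yE zE.
have sz : size y = size z by have := congr1 size yz; rewrite !size_cat => /addIn.
by have /eqP := yz; rewrite eqseq_cat // => /andP[/eqP].
Qed.

Lemma restriction_anti f g : restriction f g -> restriction g f -> f = g.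
Proof.
move=> fg gf; apply/funext => x; case fx: (f x) => [y|]; first exact/esym/fg.
by case gx: (g x) => [y|//]; rewrite -fx; apply: gf.
Qed.

Lemma fin_gen_sub R (s : seq (seq A)) : right_ideal R ->
  (forall x, R x -> exists p, [/\ p \in s, R p & exists w, x = p ++ w]) ->
  fin_gen R.
Proof.
move=> RI sP; exists [seq p <- s | `[< R p >]]; apply/seteqP; split=> x /=.
  move=> /sP[p [ps Rp xE]]; exists p => //; rewrite mem_filter ps andbT.
  exact/asboolP.
move=> [p]; rewrite mem_filter => /andP[/asboolP Rp _] [w ->]; exact: RI.
Qed.

Lemma max_ess_eq_extension_ex f : riHom f ->
  exists g, max_ess_eq_extension f g
    /\ forall h, riHom h -> ess_eq_restriction f h -> restriction h g.
Proof.
move=> fH.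
pose E h := riHom h /\ ess_eq_restriction f h.
pose u : pfun A := fun x =>
  xget None [set o | exists h, [/\ E h, dom h x & o = h x]].
have uP h x y : E h -> h x = Some y -> u x = Some y.
  move=> Eh hx; rewrite /u; apply: xget_unique.
    by exists h; split=> //; exists y.
  move=> _ [h' [Eh' [z h'x] ->]]; rewrite h'x.
  by rewrite (ess_agree Eh'.1 Eh'.2 Eh.1 Eh.2 h'x hx).
have uE x y : u x = Some y -> exists2 h, E h & h x = Some y.
  by rewrite /u; case: xgetP => // _ _ [h [Eh _ ->]] hx; exists h.
have uR : right_ideal (dom u).
  move=> x w [y /uE[h Eh hx]]; exists (y ++ w); apply: (uP h) => //.
  exact: Eh.1.1.2.
have fu : ess_eq_restriction f u.
  split; first by move=> x y; apply: uP; split=> //; apply: ess_refl.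
  split=> //; first exact: fH.1.1.
    by move=> x [y fx]; exists y; apply: uP fx; split=> //; apply: ess_refl.
  move=> I RI [x Ix] sI; have [y /uE[h Eh hx]] := sI x Ix.
  have [|w fw] := @ess_meet f h x Eh.2; first by exists y.
  by exists (x ++ w); split=> //; apply: RI.
have uH : riHom u.
  split; first split=> //.
    move=> x y w /uE[h Eh hx]; apply: (uP h) => //; exact: Eh.1.1.2.
  have [s fs] := fH.2.
  apply: (@fin_gen_sub _
    (s ++ [seq take i p | p <- s, i <- iota 0 (size p).+1])) => // x ux.
  have [w] := ess_meet fu ux; rewrite fs => -[p ps [v xwE]].
  have [px|xp] := leqP (size p) (size x).
    exists p; split; first by rewrite mem_cat ps.
      have : dom f p by rewrite fs; exists p => //; exists [::]; rewrite cats0.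
      by move=> [y fp]; exists y; apply: fu.1.
    exists (drop (size p) x).
    have := congr1 (take (size p)) xwE; rewrite take_size_cat // takel_cat //.
    by move=> {1}<-; rewrite cat_take_drop.
  have xE : x = take (size x) p.
    by rewrite -[LHS](take_size_cat w (erefl (size x))) xwE takel_cat // ltnW.
  exists x; split=> //; last by exists [::]; rewrite cats0.
  rewrite mem_cat; apply/orP; right; apply/allpairsPdep.
  by exists p, (size x); rewrite mem_iota add0n ltnS (ltnW xp).
exists u; split; last by move=> h hH fh x y; apply: uP.
split=> // h hH fh uh; apply: restriction_anti => // x y; exact: uP.
Qed.

Lemma max_ess_eq_extension_uniq f g g' : riHom f ->
  max_ess_eq_extension f g -> max_ess_eq_extension f g' -> g = g'.
Proof.
move=> /max_ess_eq_extension_ex[u [[uH fu _] uM]] [gH fg gM] [g'H fg' g'M].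
by rewrite -(gM u uH fu (uM g gH fg)) (g'M u uH fu (uM g' g'H fg')).
Qed.

Lemma maxextP f : riHom f -> max_ess_eq_extension f (maxext f).
Proof.
by move=> /max_ess_eq_extension_ex[g [gP _]]; apply: (xgetI f gP).
Qed.

Lemma maxext_unique f g : riHom f -> max_ess_eq_extension f g -> maxext f = g.
Proof. by move=> fH; apply: max_ess_eq_extension_uniq => //; apply: maxextP. Qed.

Lemma Mk1_riHom f : Mk1 f -> riHom f.
Proof. by move=> [g gH <-]; have [] := maxextP gH. Qed.

Lemma pcomp_riHom f g : riHom f -> riHom g -> riHom (pcomp g f).
Proof.
move=> [[fR fM] [s fs]] [[gR gM] [t gt]].
have cM x y w : pcomp g f x = Some y -> pcomp g f (x ++ w) = Some (y ++ w).
  rewrite /pcomp; case fx: (f x) => [z|//] /= gz.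
  by rewrite (fM _ _ _ fx) /= (gM _ _ _ gz).
have cR : right_ideal (dom (pcomp g f)).
  by move=> x w [y cx]; exists (y ++ w); apply: cM.
split=> //.
apply: (@fin_gen_sub _
  [seq p ++ drop (size (odflt [::] (f p))) q | p <- s, q <- t]) => //.
move=> x [z]; rewrite /pcomp; case fx: (f x) => [b|//] /= gb.
have : dom f x by exists b.
rewrite fs => -[p ps [w xE]].
have : dom f p by rewrite fs; exists p => //; exists [::]; rewrite cats0.
move=> [y fp]; have bE : b = y ++ w.
  by apply: Some_inj; rewrite -fx xE (fM _ _ _ fp).
have : dom g b by exists z.
rewrite gt => -[q qt [v bqE]].
have gq : dom g q by rewrite gt; exists q => //; exists [::]; rewrite cats0.
exists (p ++ drop (size y) q); split.
- by apply/allpairsP; exists (p, q); rewrite fp.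
- rewrite /dom /= (fM _ _ _ fp) /=.
  have [qy|/ltnW yq] := leqP (size q) (size y).
    rewrite drop_oversize // cats0.
    have -> : y = q ++ drop (size q) y.
      have := congr1 (take (size q)) (etrans (esym bE) bqE).
      by rewrite takel_cat // take_size_cat // => {1}<-; rewrite cat_take_drop.
    exact: gR.
  suff -> : y ++ drop (size y) q = q by [].
  have := congr1 (take (size y)) (etrans (esym bE) bqE).
  by rewrite take_size_cat // takel_cat // => {1}->; rewrite cat_take_drop.
- have [qy|/ltnW yq] := leqP (size q) (size y).
    by exists w; rewrite drop_oversize // cats0.
  exists v; rewrite xE -catA; congr (_ ++ _).
  have := congr1 (drop (size y)) (etrans (esym bE) bqE).
  rewrite drop_size_cat // drop_cat; move: yq.
  rewrite leq_eqVlt => /orP[/eqP->|->//].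
  by rewrite ltnn subnn drop0 drop_size.
Qed.

Lemma Mk1_mul f g : Mk1 f -> Mk1 g -> Mk1 (Mmul g f).
Proof.
move=> /Mk1_riHom fH /Mk1_riHom gH.
by exists (pcomp g f) => //; apply: pcomp_riHom.
Qed.

End ThompsonHigman.

(* Main.v *)
Require Import Defs.
From mathcomp Require Import all_boot all_classical.

(** Up to essential equality, an element of [riHom] is determined by its values
    on all sufficiently long words, so [psi <=_L phi] means that [psi] and
    [tau o phi] agree on long words for some [tau].  If moreover
    [phi <=_L psi] fails, then [tau] is not essentially injective and total on
    the image of [phi]: either (a) [tau] is undefined on a cone [q A^*] with
    [q] in the image, or (b) [tau u = tau v] for two words [u <> v] of the
    image.  With letters [a <> b], let [sigma] be the identity on long words
    except on one cone: it is undefined on [qa A^*] in case (a), and sends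
    [vaw] to [uaw] in case (b).  Then [tau o sigma] agrees with [tau] on long
    words, and [sigma o phi] is strictly between: it spoils [phi] along the
    letter [a], but is still finer than [psi] along the letter [b]. *)

Set Implicit Arguments.
Unset Strict Implicit.
Unset Printing Implicit Defensive.

Local Open Scope classical_set_scope.

(* [ssrfun] has a homonymous [pcomp]. *)
Local Notation pcomp := Defs.pcomp.

Section LongWords.
Variable A : finType.
Implicit Types (R : set (seq A)) (f g h : pfun A) (x y p q u v w r : seq A).

(** * Prefixes and lengths *)

Lemma cat_injr w : injective (cat w).
Proof. by move=> x y /eqP; rewrite eqseq_cat // => /andP[_ /eqP]. Qed.

Lemma cat_injl w : injective (cat^~ w).
Proof.
by move=> x y /(congr1 rev); rewrite /= !rev_cat => /cat_injr/(can_inj revK).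
Qed.

Lemma cat_prefix_drop p x w v :
  size p <= size x -> x ++ w = p ++ v -> x = p ++ drop (size p) x.
Proof.
move=> px /(congr1 (take (size p))).
by rewrite takel_cat // take_size_cat // => {1}<-; rewrite cat_take_drop.
Qed.

(** Once [x] is at least as long as every generator, a generator that is a prefix of [x ++ w] is
    already a prefix of [x]. *)
Lemma fin_gen_long R :
  fin_gen R -> exists n, forall x w, n <= size x -> R (x ++ w) -> R x.
Proof.
move=> [s ->]; exists (\max_(p <- s) size p) => x w nx [p ps [v xE]].
exists p => //; exists (drop (size p) x); apply: cat_prefix_drop xE.
by apply: leq_trans nx; apply: leq_bigmax_seq.
Qed.

Lemma riHomD f x y w : riHom f -> f x = Some y -> f (x ++ w) = Some (y ++ w).
Proof. by move=> [[_ fM] _]; apply: fM. Qed.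

(** A generator [p] is replaced by [f p] and the rest of the word is kept, so at most [size p]
    letters are lost. Hence long words have long images. *)
Lemma riHom_size f : riHom f ->
  exists n, forall x y, f x = Some y -> size x <= size y + n.
Proof.
move=> fH; have [s fs] := fH.2.
exists (\max_(p <- s) size p) => x y fx.
have : dom f x by exists y.
rewrite fs => -[p ps [w xE]].
have : dom f p by rewrite fs; exists p => //; exists [::]; rewrite cats0.
move=> [z fp]; move: fx; rewrite xE (riHomD _ fH fp) => -[<-].
rewrite !size_cat addnC leq_add ?leq_addl //.
exact: leq_bigmax_seq.
Qed.

(** * Agreement on long words versus essential equality *)

Definition long_eq f g := exists n, forall x, n <= size x -> f x = g x.

Lemma long_eq_refl f : long_eq f f.
Proof. by exists 0. Qed.

Lemma long_eq_sym f g : long_eq f g -> long_eq g f.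
Proof. by move=> [n fg]; exists n => x /fg. Qed.

Lemma long_eq_trans f g h : long_eq f g -> long_eq g h -> long_eq f h.
Proof.
move=> [m fg] [n gh]; exists (maxn m n) => x.
by rewrite geq_max => /andP[/fg-> /gh].
Qed.

Lemma long_eq_comp f f' g g' : riHom f ->
  long_eq f f' -> long_eq g g' -> long_eq (pcomp g f) (pcomp g' f').
Proof.
move=> /riHom_size[k fk] [m ff'] [n gg']; exists (maxn m (n + k)) => x.
rewrite geq_max /pcomp => /andP[/ff'<- nkx]; case fx: (f x) => [y|//] /=.
by apply: gg'; rewrite -(leq_add2r k) (leq_trans nkx) ?fk.
Qed.

(** Essentiality makes [f] defined on some extension of [x]; for long [x], [fin_gen_long] brings
    this back to [x]. *)
Lemma ess_long_eq f g : riHom f -> ess_eq_restriction f g -> long_eq f g.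
Proof.
move=> [_ /fin_gen_long[n fn]] fg; exists n => x nx.
case gx: (g x) => [y|]; last first.
  by case fx: (f x) => [z|//]; rewrite (fg.1 _ _ fx) in gx.
have [|w /(fn _ _ nx)[z fx]] := ess_meet (x := x) fg; first by exists y.
by rewrite fx -gx (fg.1 _ _ fx).
Qed.

(** The letter [a] pads a word of [dom g] until it is long, and there [f] is defined as well. *)
Lemma long_eq_ess (a : A) f g : riHom f -> riHom g ->
  restriction f g -> long_eq f g -> ess_eq_restriction f g.
Proof.
move=> [[fR _] _] gH fg [n fgn]; split=> //; split=> //.
- exact: gH.1.1.
- by move=> x [y /fg gx]; exists y.
- move=> I RI [x Ix] sI; have [y gx] := sI _ Ix.
  exists (x ++ nseq n a); split; last exact: RI.
  exists (y ++ nseq n a); rewrite fgn ?(riHomD _ gH gx) //.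
  by rewrite size_cat size_nseq leq_addl.
Qed.

Lemma long_eq_agree (a : A) f g x y z : riHom f -> riHom g -> long_eq f g ->
  f x = Some y -> g x = Some z -> y = z.
Proof.
move=> fH gH [n fgn] fx gx; have := fgn (x ++ nseq n a).
rewrite size_cat size_nseq leq_addl (riHomD _ fH fx) (riHomD _ gH gx).
by move=> /(_ isT)[/cat_injl].
Qed.

Lemma maxext_long_eq f : riHom f -> long_eq (maxext f) f.
Proof.
by move=> fH; have [_ fM _] := maxextP fH; apply/long_eq_sym/ess_long_eq.
Qed.

Lemma Mk1_maxext f : riHom f -> Mk1 (maxext f).
Proof. by move=> fH; exists f. Qed.

(* The union of [maxext f] and [g] is an essentially equal extension of [f]. *)
Lemma long_eq_restriction (a : A) f g : riHom f -> riHom g ->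
  long_eq f g -> restriction g (maxext f).
Proof.
move=> fH gH fg; have [FH fF Fmax] := maxextP fH.
have Ff := maxext_long_eq fH; have Fg := long_eq_trans Ff fg.
move: FH fF Fmax Ff Fg; set F := maxext f => FH fF Fmax Ff Fg.
pose u : pfun A := fun x => if F x is Some y then Some y else g x.
have Fu : restriction F u by move=> x y; rewrite /u => ->.
have gu : restriction g u.
  move=> x y gx; rewrite /u; case Fx: (F x) => [z|//].
  by rewrite (long_eq_agree a FH gH Fg Fx gx).
have uE x y : u x = Some y -> F x = Some y \/ g x = Some y.
  by rewrite /u; case: (F x); [left|right].
have uD x y w : u x = Some y -> u (x ++ w) = Some (y ++ w).
  by move=> /uE[Fx|gx]; [apply/Fu/riHomD|apply/gu/riHomD].
have domu : dom u = dom F `|` dom g.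
  apply/seteqP; split=> x.
    by move=> [y /uE[]]; [left|right]; exists y.
  by case=> -[y]; [move=> /Fu|move=> /gu]; exists y.
have uH : riHom u.
  split; first by split=> // x w [y /uD ux]; exists (y ++ w).
  have [s Fs] := FH.2; have [t gt] := gH.2; exists (s ++ t).
  rewrite domu Fs gt; apply/seteqP; split=> x.
    by case=> -[p ps xE]; exists p; rewrite // mem_cat ps ?orbT.
  by move=> [p]; rewrite mem_cat => /orP[ps|pt] xE; [left|right]; exists p.
have fu : ess_eq_restriction f u.
  apply: (long_eq_ess a) => //; first by move=> x y /fF.1/Fu.
  apply: long_eq_trans (long_eq_sym Ff) _.
  have [n Fgn] := Fg; exists n => x /Fgn; rewrite /u.
  by case: (F x).
by rewrite -(Fmax u uH fu Fu).
Qed.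

Lemma long_eq_maxext (a : A) f g : riHom f -> riHom g ->
  long_eq f g -> maxext f = maxext g.
Proof.
move=> fH gH fg; have [FH _ _] := maxextP fH; have [GH _ _] := maxextP gH.
apply: restriction_anti; apply: (long_eq_restriction a) => //.
  exact: long_eq_trans (long_eq_sym fg) (long_eq_sym (maxext_long_eq fH)).
exact: long_eq_trans fg (long_eq_sym (maxext_long_eq gH)).
Qed.

(** * The L-order in terms of long words *)

Lemma leLP (a : A) f g : Mk1 f -> Mk1 g ->
  leL f g <-> exists2 h, riHom h & long_eq f (pcomp h g).
Proof.
move=> fM gM; have gH := Mk1_riHom gM; split.
  move=> [h /Mk1_riHom hH ->]; exists h => //.
  exact/maxext_long_eq/pcomp_riHom.
move=> [h hH fE]; exists (maxext h); first exact: Mk1_maxext.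
have HH := Mk1_riHom (Mk1_maxext hH).
(* Writing [f] as [maxext f0] turns the goal into an equality of two maximal extensions, for which
   agreement on long words suffices. *)
have [f0 f0H f0E] := fM; rewrite -f0E /Mmul; apply: (long_eq_maxext a) => //.
  exact: pcomp_riHom.
have ff0 : long_eq f0 f by rewrite -f0E; apply/long_eq_sym/maxext_long_eq.
apply/(long_eq_trans ff0)/(long_eq_trans fE)/long_eq_comp => //.
  exact: long_eq_refl.
exact/long_eq_sym/maxext_long_eq.
Qed.

(** The two conditions on [g] exclude cases (a) and (b), so [g] can be undone on the image of [f]:
    [h] sends [g q] back to [q]. *)
Lemma riHom_retraction f g : riHom f -> riHom g ->
  (forall x q, f x = Some q -> exists w, dom g (q ++ w)) ->
  (forall x x' q q' z, f x = Some q -> f x' = Some q' ->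
     g q = Some z -> g q' = Some z -> q = q') ->
  exists2 h, riHom h & long_eq f (pcomp h (pcomp g f)).
Proof.
move=> fH gH gtot ginj.
(* Injectivity leaves at most one candidate in [S z]; the default [None] keeps [h] undefined where
   there is none. *)
pose S z := [set o | exists x q, [/\ f x = Some q, g q = Some z & o = Some q]].
pose h : pfun A := fun z => xget None (S z).
have hP x q z : f x = Some q -> g q = Some z -> h z = Some q.
  move=> fx gq; apply: xget_unique; first by exists x, q.
  move=> _ [x' [q' [fx' gq' ->]]].
  by rewrite (ginj _ _ _ _ _ fx' fx gq' gq).
have hE z q : h z = Some q -> exists2 x, f x = Some q & g q = Some z.
  rewrite /h; case: xgetP => // _ _ [x [q' [fx gq ->]]] [<-].
  by exists x.
have hD z q w : h z = Some q -> h (z ++ w) = Some (q ++ w).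
  by move=> /hE[x fx gq]; apply: (hP (x ++ w)); apply: riHomD.
have cH := pcomp_riHom fH gH.
have hH : riHom h.
  split; first by split=> // z w [q /hD hz]; exists (q ++ w).
  have [s cs] := cH.2.
  (* The values of [pcomp g f] at the generators of its domain generate [dom h]. *)
  apply: (@fin_gen_sub _ _ [seq odflt [::] (pcomp g f p) | p <- s]).
    by move=> z w [q /hD hz]; exists (q ++ w).
  move=> z [q /hE[x fx gq]].
  have cx : pcomp g f x = Some z by rewrite /pcomp fx.
  have : dom (pcomp g f) x by exists z.
  rewrite cs => -[p ps [w xE]].
  have : dom (pcomp g f) p.
    by rewrite cs; exists p => //; exists [::]; rewrite cats0.
  move=> [y cp]; exists y; split.
  - by apply/mapP; exists p; rewrite // cp.
  - move: cp; rewrite /pcomp; case fp: (f p) => [r|//] /= gr.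
    by exists r; apply: hP fp gr.
  - by exists w; move: cx; rewrite xE (riHomD _ cH cp) => -[].
exists h => //; have [n gn] := fin_gen_long gH.2; have [k fk] := riHom_size fH.
(* Up to [k] letters may be lost under [f], and [n] must remain for [fin_gen_long] to apply to
   [dom g] at [q]. *)
exists (n + k) => x nx; rewrite /pcomp; case fx: (f x) => [q|//] /=.
have [w gqw] := gtot _ _ fx.
have [|z gq] := gn _ _ _ gqw.
  by rewrite -(leq_add2r k) (leq_trans nx) ?fk.
by rewrite gq /= (hP _ _ _ fx gq).
Qed.

Definition redirect r (o : option (seq A)) : pfun A := fun x =>
  if size x < size r then None
  else if prefix r x then omap (cat^~ (drop (size r) x)) o else Some x.

Lemma redirect_prefix r o w : redirect r o (r ++ w) = omap (cat^~ w) o.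
Proof.
by rewrite /redirect size_cat ltnNge leq_addr prefix_prefix drop_size_cat.
Qed.

Lemma redirect_id r o x :
  size r <= size x -> (forall w, x <> r ++ w) -> redirect r o x = Some x.
Proof.
by rewrite /redirect leqNgt => /negbTE-> xr; case: prefixP => // -[w /xr].
Qed.

Lemma redirect_riHom r o : riHom (redirect r o).
Proof.
have redD x y w : redirect r o x = Some y ->
    redirect r o (x ++ w) = Some (y ++ w).
  have [xr|rx] := ltnP (size x) (size r); first by rewrite {1}/redirect xr.
  have [[v ->]|nrx] := pselect (exists v, x = r ++ v).
    rewrite -catA !redirect_prefix; case: o => //= s [<-].
    by rewrite catA.
  rewrite redirect_id // => [[<-]|v xE]; last by apply: nrx; exists v.
  rewrite redirect_id //; first by rewrite size_cat (leq_trans rx) ?leq_addr.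
  move=> v /(cat_prefix_drop rx) xE.
  by apply: nrx; exists (drop (size r) x).
have redR : right_ideal (dom (redirect r o)).
  by move=> x w [y /redD xy]; exists (y ++ w).
(* All words of length [size r] are candidate generators; [fin_gen_sub] keeps those in the
   domain. *)
split=> //; pose s := [seq val t | t : (size r).-tuple A].
apply: (fin_gen_sub (s := s)) => // x [y xy].
have [xr|rx] := ltnP (size x) (size r); first by rewrite /redirect xr in xy.
have tP : size (take (size r) x) == size r by rewrite size_takel.
exists (take (size r) x); split.
- by apply/mapP; exists (Tuple tP); rewrite ?mem_enum.
- have := xy; rewrite -{1}(cat_take_drop (size r) x).
  have [[v ->]|nrx] := pselect (exists v, x = r ++ v).
    rewrite take_size_cat // redirect_prefix /dom /=.
    have := redirect_prefix r o [::]; rewrite cats0 => ->.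
    by case: o {xy redD redR} => //= t _; exists (t ++ [::]).
  move=> _; exists (take (size r) x); apply: redirect_id.
    by rewrite size_takel.
  move=> w /(congr1 (cat^~ (drop (size r) x))).
  by rewrite /= cat_take_drop -catA => xE; apply: nrx; eexists; exact: xE.
- by exists (drop (size r) x); rewrite cat_take_drop.
Qed.

(** Outside the cone of [r], all words of length at least [size r] are fixed, so only the cone has
    to be compared. *)
Lemma pcomp_redirect f r o :
  (forall w, obind f (omap (cat^~ w) o) = f (r ++ w)) ->
  long_eq (pcomp f (redirect r o)) f.
Proof.
move=> fr; exists (size r) => x rx; rewrite /pcomp.
have [[w ->]|nrx] := pselect (exists w, x = r ++ w).
  by rewrite redirect_prefix fr.
by rewrite redirect_id // => w xE; apply: nrx; exists w.
Qed.

(** * The intermediate element *)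

Section Between.
Variables (phi psi tau : pfun A) (a b : A).
Hypotheses (phiM : Mk1 phi) (psiM : Mk1 psi) (tauH : riHom tau) (ab : a <> b).
Hypothesis psiE : long_eq psi (pcomp tau phi).

(** The witness is [maxext (pcomp sigma phi)]: as [tau] absorbs [sigma], [tau] still leads from it
    to [psi]. The last two hypotheses give strictness on either side. *)
Lemma between_long_eq sigma : riHom sigma ->
  long_eq (pcomp tau sigma) tau ->
  (forall rho, ~ long_eq phi (pcomp rho (pcomp sigma phi))) ->
  (forall rho, ~ long_eq (pcomp sigma phi) (pcomp rho (pcomp tau phi))) ->
  exists chi, Mk1 chi /\ gtL phi chi /\ gtL chi psi.
Proof.
move=> sH tsE nphi nchi; have phiH := Mk1_riHom phiM.
have cH := pcomp_riHom phiH sH.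
have chiM := Mk1_maxext cH; have chiE := maxext_long_eq cH.
have compl rho f g : riHom f -> long_eq f g ->
    long_eq (pcomp rho f) (pcomp rho g).
  by move=> fH fg; apply: long_eq_comp fg (long_eq_refl _).
exists (maxext (pcomp sigma phi)); split=> //; split; split.
- by apply/(leLP a) => //; exists sigma.
- move=> [_ /(leLP a phiM chiM)[rho rhoH phiE]]; apply: (nphi rho).
  exact/(long_eq_trans phiE)/compl/chiE/Mk1_riHom.
- apply/(leLP a) => //; exists tau => //; apply: (long_eq_trans psiE).
  apply: long_eq_trans (compl tau _ _ cH (long_eq_sym chiE)).
  have -> : pcomp tau (pcomp sigma phi) = pcomp (pcomp tau sigma) phi.
    by apply/funext => x; rewrite /pcomp; case: (phi x).
  by apply/long_eq_comp/long_eq_sym => //; apply: long_eq_refl.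
- move=> [_ /(leLP a chiM psiM)[rho rhoH]] chipsi; apply: (nchi rho).
  apply: long_eq_trans (long_eq_sym chiE) (long_eq_trans chipsi _).
  exact/compl/psiE/Mk1_riHom.
Qed.

Lemma between_undefined p q : phi p = Some q ->
  (forall w, ~ dom tau (q ++ w)) ->
  exists chi, Mk1 chi /\ gtL phi chi /\ gtL chi psi.
Proof.
move=> phip tauN; have phiH := Mk1_riHom phiM.
have tauq w : tau (q ++ w) = None.
  by case tq: (tau _) => [z|//]; case: (tauN w); exists z.
apply: (between_long_eq (redirect_riHom (rcons q a) None)).
- by apply: pcomp_redirect => w /=; rewrite cat_rcons tauq.
(* Along [a], [sigma] is undefined at the image of a long word in [dom phi]. *)
- move=> rho [n phiE].
  have := phiE (p ++ a :: nseq n a); rewrite size_cat /= size_nseq.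
  rewrite addnS -addSn leq_addl => /(_ isT).
  by rewrite /pcomp (riHomD _ phiH phip) /= -cat_rcons redirect_prefix.
(* Along [b], [sigma] fixes such an image, while [tau] is undefined there. *)
- move=> rho [n chiE].
  have := chiE (p ++ b :: nseq n a); rewrite size_cat /= size_nseq.
  rewrite addnS -addSn leq_addl => /(_ isT).
  rewrite /pcomp (riHomD _ phiH phip) /= tauq /= redirect_id //.
    by rewrite size_rcons size_cat addnS ltnS leq_addr.
  by move=> w; rewrite cat_rcons => /cat_injr[/esym].
Qed.

Lemma between_collision p p' u v z : phi p = Some u -> phi p' = Some v ->
  tau u = Some z -> tau v = Some z -> u <> v ->
  exists chi, Mk1 chi /\ gtL phi chi /\ gtL chi psi.
Proof.
move=> phip phip' tauu tauv uv; have phiH := Mk1_riHom phiM.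
(* Applying [tau] shows that the cones of [u] and [v] are disjoint. *)
have cones w w' : u ++ w <> v ++ w'.
  move=> uvw; have := riHomD w tauH tauu; rewrite uvw (riHomD w' tauH tauv) => -[].
  by move=> /cat_injr ww'; apply/uv/(@cat_injl w); rewrite uvw ww'.
pose sigma := redirect (rcons v a) (Some (rcons u a)).
have su w : size v < size w -> sigma (u ++ w) = Some (u ++ w).
  move=> vw; apply: redirect_id => [|w']; last by rewrite cat_rcons.
  by rewrite size_rcons size_cat ltn_addl.
(* The extra [size v] letters bring [u ++ c :: W n] into the domain of [sigma] even when [u] is
   shorter than [v]. *)
pose W n := nseq (n + size v) a.
have sizeW n x c : n <= size (x ++ c :: W n).
  by rewrite size_cat /= size_nseq -addSnnS addnA addnAC leq_addl.
have vW c n : size v < size (c :: W n) by rewrite /= size_nseq ltnS leq_addl.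
apply: (between_long_eq (redirect_riHom (rcons v a) (Some (rcons u a)))).
- apply: pcomp_redirect => w /=.
  by rewrite !cat_rcons (riHomD _ tauH tauu) (riHomD _ tauH tauv).
(* Along [a], [sigma] merges two distinct values of [phi], which no [rho] can separate again. *)
- move=> rho [n phiE].
  have := phiE _ (sizeW n p a); have := phiE _ (sizeW n p' a).
  rewrite /pcomp (riHomD _ phiH phip) (riHomD _ phiH phip') /= -/sigma.
  rewrite su ?vW // -(cat_rcons a v) /sigma redirect_prefix /= !cat_rcons => <-.
  by move=> -[/cones].
(* Along [b], [sigma] fixes two distinct values of [phi] that [tau] merges. *)
- move=> rho [n chiE].
  have := chiE _ (sizeW n p b); have := chiE _ (sizeW n p' b).
  rewrite /pcomp (riHomD _ phiH phip) (riHomD _ phiH phip') /= -/sigma.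
  rewrite (riHomD _ tauH tauu) (riHomD _ tauH tauv) su ?vW //= => <-.
  rewrite /sigma redirect_id => [[/cones]//||w].
    by rewrite size_rcons size_cat addnS ltnS leq_addr.
  by rewrite cat_rcons => /cat_injr[/esym].
Qed.

End Between.

End LongWords.

Theorem proposition4p5 (k : nat) (hk : 2 <= k) (A : finType) (hA : #|A| = k)
    (phi psi : pfun A) (hphi : Mk1 phi) (hpsi : Mk1 psi) :
  gtL phi psi -> exists chi : pfun A, Mk1 chi /\ gtL phi chi /\ gtL chi psi.
Proof.
have /fintype.card_gt1P[a [b [_ _ /eqP ab]]] : 1 < #|A| by rewrite hA.
move=> [psiphi neqL]; have phiH := Mk1_riHom hphi.
have /(leLP a hpsi hphi)[tau tauH psiE] := psiphi.
(* Without an intermediate element neither (a) nor (b) occurs, so [phi] is recovered from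
   [pcomp tau phi], hence from [psi], on long words. *)
apply: contrapT => nchi; apply: neqL; split=> //; apply/(leLP a) => //.
have [||rho rhoH phiE] := riHom_retraction phiH tauH.
- move=> p q phip; apply: contrapT => tauN; apply: nchi.
  apply: (between_undefined (tau := tau) hphi hpsi _ ab psiE phip) => //.
  by move=> w tauq; apply: tauN; exists w.
- move=> p p' u v z phip phip' tauu tauv; apply: contrapT => uv; apply: nchi.
  exact: (between_collision hphi hpsi tauH ab psiE phip phip' tauu tauv uv).
- exists rho => //; apply: (long_eq_trans phiE).
  apply: long_eq_comp (long_eq_sym psiE) (long_eq_refl _).
  exact: pcomp_riHom.
Qed.
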